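(* Let $n\ge 2$ and $q\in K^*$. There are (unital) algebra morphisms $\Delta:T_q(n)\to T_q(n)\otimes T_q(n)$ and $\varepsilon:T_q(n)\to K$ given by $$\Delta(a_{ij})=\sum_{k=i}^j a_{ik}\otimes a_{kj},\qquad \varepsilon(a_{ij})=\delta_{ij},\qquad 1\le i\le j\le n.$$ These define a bialgebra structure on $T_q(n)$.
   Context: $K$ is a field of characteristic different from $2$; tensor products and algebras are over $K$; $K^*=K\setminus\{0\}$; $\delta_{ij}$ is the Kronecker delta. For $n\ge 2$ and $q\in K^*$, $T_q(n)$ is the unital associative $K$-algebra with generators $a_{ij}$, $1\le i\le j\le n$, and defining relations (all indices such that the generators involved exist): $a_{jk}a_{ik}=q\,a_{ik}a_{jk}$ for $i<j\le k$; $a_{jk}a_{jl}=q\,a_{jl}a_{jk}$ for $j\le k<l$; $a_{ik}a_{jl}=a_{jl}a_{ik}$ for $i<j\le l$, $i\le k<l$; $a_{jk}a_{il}=q^2a_{il}a_{jk}$ for $i<j\le k<l$. *)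

(* Defs.v *)
From HB Require Import structures.
From mathcomp Require Import all_boot all_algebra finmap.
From mathcomp Require Import boolp.
From mathcomp Require classical_sets.
From mathcomp.multinomials Require Import monalg.

Set Implicit Arguments.
Unset Strict Implicit.
Unset Printing Implicit Defensive.

Import GRing.Theory.
Local Open Scope ring_scope.
Local Open Scope quotient_scope.


Inductive spanned (K : fieldType) (V : lmodType K) (S : V -> Prop) : V -> Prop :=
| spanned_incl x of S x : spanned S x
| spanned_zero : spanned S 0
| spanned_lin c x y of spanned S x & spanned S y : spanned S (c *: x + y).

Definition span (K : fieldType) (V : lmodType K) (S : V -> Prop) : {pred V} :=
  fun x => `[< spanned S x >].

Section LmodQuot.
Variables (K : fieldType) (V : lmodType K) (S : V -> Prop).

Lemma spanP x : reflect (spanned S x) (x \in span S).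
Proof. exact: asboolP. Qed.

Lemma span_incl x : S x -> x \in span S.
Proof. by move=> Sx; apply/spanP/spanned_incl. Qed.

Lemma span_zmod_closed : zmod_closed (span S).
Proof.
split=> [|x y /spanP Sx /spanP Sy]; apply/spanP; first exact: spanned_zero.
by rewrite addrC -scaleN1r; apply: spanned_lin.
Qed.

HB.instance Definition _ := GRing.isZmodClosed.Build V (span S) span_zmod_closed.

Lemma spanZ c x : x \in span S -> c *: x \in span S.
Proof.
move=> /spanP Sx; apply/spanP; rewrite -[_ *: _]addr0.
by apply: spanned_lin => //; apply: spanned_zero.
Qed.

Definition lmod_quot : Type := Quotient.quot (span S).
HB.instance Definition _ := GRing.Zmodule.on lmod_quot.
HB.instance Definition _ := EqQuotient.on lmod_quot.

Definition lmod_pi (x : V) : lmod_quot := \pi_(Quotient.quot (span S)) x.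
Definition lmod_repr (x : lmod_quot) : V := repr (x : Quotient.quot (span S)).

Lemma lmod_piE x y : (lmod_pi x = lmod_pi y) <-> x - y \in span S.
Proof. by rewrite Quotient.idealrBE; split=> [/eqP|/eqP]. Qed.

Lemma lmod_reprK x : lmod_pi (lmod_repr x) = x.
Proof. exact: reprK. Qed.

Lemma lmod_piD x y : lmod_pi (x + y) = lmod_pi x + lmod_pi y.
Proof. exact: Quotient.pi_add. Qed.

Definition lmod_quot_scale (c : K) (x : lmod_quot) : lmod_quot :=
  lmod_pi (c *: lmod_repr x).

Lemma lmod_quot_scaleE c x : lmod_quot_scale c (lmod_pi x) = lmod_pi (c *: x).
Proof.
by apply/lmod_piE; rewrite -scalerBr; apply/spanZ/lmod_piE; rewrite lmod_reprK.
Qed.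

Fact lmod_quot_scaleA a b x :
  lmod_quot_scale a (lmod_quot_scale b x) = lmod_quot_scale (a * b) x.
Proof. by rewrite -[x]lmod_reprK !lmod_quot_scaleE scalerA. Qed.
Fact lmod_quot_scale1 : left_id 1 lmod_quot_scale.
Proof. by move=> x; rewrite -[x]lmod_reprK lmod_quot_scaleE scale1r. Qed.
Fact lmod_quot_scaleDr : right_distributive lmod_quot_scale +%R.
Proof.
move=> c x y; rewrite -[x]lmod_reprK -[y]lmod_reprK -lmod_piD !lmod_quot_scaleE.
by rewrite scalerDr lmod_piD.
Qed.
Fact lmod_quot_scaleDl x : {morph lmod_quot_scale^~ x : a b / a + b}.
Proof.
move=> a b; rewrite -[x]lmod_reprK !lmod_quot_scaleE.
by rewrite scalerDl lmod_piD.
Qed.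

HB.instance Definition _ := GRing.Zmodule_isLmodule.Build K lmod_quot
  lmod_quot_scaleA lmod_quot_scale1 lmod_quot_scaleDr lmod_quot_scaleDl.

Lemma lmod_pi_linear : linear lmod_pi.
Proof. by move=> c x y; rewrite lmod_piD -lmod_quot_scaleE. Qed.

HB.instance Definition _ :=
  GRing.isLinear.Build K V lmod_quot *:%R lmod_pi lmod_pi_linear.

End LmodQuot.


Inductive ideal_gen (K : fieldType) (A : algType K) (S : A -> Prop) : A -> Prop :=
| ideal_gen_incl x of S x : ideal_gen S x
| ideal_gen_zero : ideal_gen S 0
| ideal_gen_sub x y of ideal_gen S x & ideal_gen S y : ideal_gen S (x - y)
| ideal_gen_mull a x of ideal_gen S x : ideal_gen S (a * x)
| ideal_gen_mulr a x of ideal_gen S x : ideal_gen S (x * a).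

Definition ideal (K : fieldType) (A : algType K) (S : A -> Prop) : {pred A} :=
  fun x => `[< ideal_gen S x >].

Section IdealClosed.
Variables (K : fieldType) (A : algType K) (S : A -> Prop).

Lemma idealP x : reflect (ideal_gen S x) (x \in ideal S).
Proof. exact: asboolP. Qed.

Lemma ideal_incl x : S x -> x \in ideal S.
Proof. by move=> Sx; apply/idealP/ideal_gen_incl. Qed.

Lemma ideal_zmod_closed : zmod_closed (ideal S).
Proof.
split=> [|x y /idealP Sx /idealP Sy]; apply/idealP; first exact: ideal_gen_zero.
exact: ideal_gen_sub.
Qed.

HB.instance Definition _ :=
  GRing.isZmodClosed.Build A (ideal S) ideal_zmod_closed.

Lemma ideal_mull a x : x \in ideal S -> a * x \in ideal S.
Proof. by move=> /idealP Sx; apply/idealP/ideal_gen_mull. Qed.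

Lemma ideal_mulr a x : x \in ideal S -> x * a \in ideal S.
Proof. by move=> /idealP Sx; apply/idealP/ideal_gen_mulr. Qed.

Lemma idealZ c x : x \in ideal S -> c *: x \in ideal S.
Proof. by move=> Sx; rewrite -[x]mul1r scalerAl; apply: ideal_mull. Qed.

End IdealClosed.

(* Rings are nontrivial in [algType], hence the properness argument; it is     *)
(* part of the type so that the instances below can be inferred.              *)
Section AlgQuot.
Variables (K : fieldType) (A : algType K) (S : A -> Prop).
Variable properS : 1 \notin ideal S.

Definition alg_quot of 1 \notin ideal S : Type := Quotient.quot (ideal S).
Local Notation Q := (alg_quot properS).

HB.instance Definition _ := GRing.Zmodule.on Q.

Definition alg_pi (x : A) : Q := \pi_(Quotient.quot (ideal S)) x.
Definition alg_repr (x : Q) : A := repr (x : Quotient.quot (ideal S)).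

Lemma alg_piE x y : (alg_pi x = alg_pi y) <-> x - y \in ideal S.
Proof. by rewrite Quotient.idealrBE; split=> [/eqP|/eqP]. Qed.

Lemma alg_reprK x : alg_pi (alg_repr x) = x.
Proof. exact: reprK. Qed.

Lemma alg_piD x y : alg_pi (x + y) = alg_pi x + alg_pi y.
Proof. exact: Quotient.pi_add. Qed.

Definition alg_quot_mul (x y : Q) : Q := alg_pi (alg_repr x * alg_repr y).
Definition alg_quot_scale (c : K) (x : Q) : Q := alg_pi (c *: alg_repr x).

Lemma alg_quot_mulE x y : alg_quot_mul (alg_pi x) (alg_pi y) = alg_pi (x * y).
Proof.
apply/alg_piE; set x' := alg_repr _; set y' := alg_repr _.
have -> : x' * y' - x * y = (x' - x) * y' + x * (y' - y).
  by rewrite mulrBl mulrBr addrA subrK.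
apply: rpredD; [apply: ideal_mulr | apply: ideal_mull];
  by apply/alg_piE; rewrite alg_reprK.
Qed.

Lemma alg_quot_scaleE c x : alg_quot_scale c (alg_pi x) = alg_pi (c *: x).
Proof.
by apply/alg_piE; rewrite -scalerBr; apply/idealZ/alg_piE; rewrite alg_reprK.
Qed.

Let E := (alg_quot_mulE, alg_quot_scaleE, =^~ alg_piD).

Fact alg_quot_mulA : associative alg_quot_mul.
Proof.
move=> x y z; rewrite -[x]alg_reprK -[y]alg_reprK -[z]alg_reprK.
by rewrite !E mulrA.
Qed.
Fact alg_quot_mul1q : left_id (alg_pi 1) alg_quot_mul.
Proof. by move=> x; rewrite -[x]alg_reprK !E mul1r. Qed.
Fact alg_quot_mulq1 : right_id (alg_pi 1) alg_quot_mul.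
Proof. by move=> x; rewrite -[x]alg_reprK !E mulr1. Qed.
Fact alg_quot_mulDl : left_distributive alg_quot_mul +%R.
Proof.
move=> x y z; rewrite -[x]alg_reprK -[y]alg_reprK -[z]alg_reprK.
by rewrite !E mulrDl.
Qed.
Fact alg_quot_mulDr : right_distributive alg_quot_mul +%R.
Proof.
move=> x y z; rewrite -[x]alg_reprK -[y]alg_reprK -[z]alg_reprK.
by rewrite !E mulrDr.
Qed.
Fact alg_quot_1neq0 : alg_pi 1 != 0.
Proof.
have pi0 : alg_pi 0 = 0.
  by apply: (addIr (alg_pi 0)); rewrite -alg_piD !add0r.
apply: contraNneq properS; rewrite -pi0 => /alg_piE.
by rewrite subr0.
Qed.

HB.instance Definition _ := GRing.Zmodule_isNzRing.Build Q alg_quot_mulA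
  alg_quot_mul1q alg_quot_mulq1 alg_quot_mulDl alg_quot_mulDr alg_quot_1neq0.

Fact alg_quot_scaleA a b x :
  alg_quot_scale a (alg_quot_scale b x) = alg_quot_scale (a * b) x.
Proof. by rewrite -[x]alg_reprK !E scalerA. Qed.
Fact alg_quot_scale1 : left_id 1 alg_quot_scale.
Proof. by move=> x; rewrite -[x]alg_reprK !E scale1r. Qed.
Fact alg_quot_scaleDr : right_distributive alg_quot_scale +%R.
Proof.
by move=> c x y; rewrite -[x]alg_reprK -[y]alg_reprK !E scalerDr.
Qed.
Fact alg_quot_scaleDl x : {morph alg_quot_scale^~ x : a b / a + b}.
Proof. by move=> a b; rewrite -[x]alg_reprK !E scalerDl. Qed.

HB.instance Definition _ := GRing.Zmodule_isLmodule.Build K Q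
  alg_quot_scaleA alg_quot_scale1 alg_quot_scaleDr alg_quot_scaleDl.

Fact alg_quot_scaleAl c (x y : Q) : c *: (x * y) = (c *: x) * y.
Proof.
rewrite -[x]alg_reprK -[y]alg_reprK.
change (alg_quot_scale c (alg_quot_mul (alg_pi (alg_repr x)) (alg_pi (alg_repr y)))
  = alg_quot_mul (alg_quot_scale c (alg_pi (alg_repr x))) (alg_pi (alg_repr y))).
by rewrite !E scalerAl.
Qed.

HB.instance Definition _ := GRing.Lmodule_isLalgebra.Build K Q alg_quot_scaleAl.

Fact alg_quot_scaleAr c (x y : Q) : c *: (x * y) = x * (c *: y).
Proof.
rewrite -[x]alg_reprK -[y]alg_reprK.
change (alg_quot_scale c (alg_quot_mul (alg_pi (alg_repr x)) (alg_pi (alg_repr y)))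
  = alg_quot_mul (alg_pi (alg_repr x)) (alg_quot_scale c (alg_pi (alg_repr y)))).
by rewrite !E scalerAr.
Qed.

HB.instance Definition _ := GRing.Lalgebra_isAlgebra.Build K Q alg_quot_scaleAr.

Lemma alg_pi_linear : linear alg_pi.
Proof.
by move=> c x y; rewrite alg_piD; congr (_ + _); rewrite -alg_quot_scaleE.
Qed.
Lemma alg_pi_monoid_morphism : monoid_morphism alg_pi.
Proof. by split=> // x y; rewrite -[RHS]/(alg_quot_mul _ _) E. Qed.

HB.instance Definition _ := GRing.isLinear.Build K A Q *:%R alg_pi alg_pi_linear.
HB.instance Definition _ :=
  GRing.isMonoidMorphism.Build A Q alg_pi alg_pi_monoid_morphism.

End AlgQuot.


(* The noncommutative polynomials over [I], that is, the monoid algebra of the *)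
(* free monoid [{fmonom I}].                                                   *)
Definition free_alg (K : fieldType) (I : choiceType) : Type :=
  {malg K[{fmonom I}]}.

Section FreeAlg.
Variables (K : fieldType) (I : choiceType).
Local Notation F := (free_alg K I).

Lemma malg_scaleAr c (g h : {malg K[{fmonom I}]}) :
  c *: (g * h) = g * (c *: h).
Proof.
have -> : c *: (g * h) = c%:MP * (g * h) by rewrite mul_malgC.
have -> : c *: h = c%:MP * h by rewrite mul_malgC.
have cg : g * c%:MP = c%:MP * g.
  rewrite [LHS]fgmulgU [RHS]fgmulUg; apply: eq_bigr => m _.
  by rewrite mul1m mulm1 mulrC.
exact: etrans (mulrA _ _ _) (etrans (congr1 ( *%R^~ h) (esym cg)) (esym (mulrA _ _ _))).
Qed.

HB.instance Definition _ := GRing.Lalgebra.on F.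
HB.instance Definition _ := GRing.Lalgebra_isAlgebra.Build K F malg_scaleAr.

Definition free_gen (i : I) : F := << fmu i >>.

End FreeAlg.


Section Tensor.
Variables (K : fieldType) (U V : lmodType K).

(* [U (x) V] is the vector space with basis the set [U * V] modulo the         *)
(* bilinearity relations.                                                      *)
Definition pre_tensor := {malg K[(U * V)%type]}.
Definition pre_tens (u : U) (v : V) : pre_tensor := << (u, v) >>.

Inductive tensor_rel : pre_tensor -> Prop :=
| tensor_rel_l c u u' v :
    tensor_rel (pre_tens (c *: u + u') v - (c *: pre_tens u v + pre_tens u' v))
| tensor_rel_r c u v v' :
    tensor_rel (pre_tens u (c *: v + v') - (c *: pre_tens u v + pre_tens u v')).

Definition tensor : Type := lmod_quot tensor_rel.
HB.instance Definition _ := GRing.Lmodule.on tensor.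

Fact tens_key : unit. Proof. by []. Qed.
Definition tens : U -> V -> tensor :=
  locked_with tens_key (fun u v => lmod_pi tensor_rel (pre_tens u v)).

Lemma tens_unlock u v : tens u v = lmod_pi tensor_rel (pre_tens u v).
Proof. by rewrite /tens unlock. Qed.

End Tensor.

Notation "u *t v" := (tens u v) (at level 40, left associativity) : ring_scope.

Section TensorLift.
Variables (K : fieldType) (U V : lmodType K).

Lemma tens_linl (v : V) : linear (fun u : U => u *t v).
Proof.
move=> c u u' /=; rewrite !tens_unlock -linearP; apply/lmod_piE/span_incl.
exact: tensor_rel_l.
Qed.

Lemma tens_linr (u : U) : linear (fun v : V => u *t v).
Proof.
move=> c v v' /=; rewrite !tens_unlock -linearP; apply/lmod_piE/span_incl.
exact: tensor_rel_r.
Qed.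

Lemma tensE (t : tensor U V) :
  exists s : seq (K * (U * V)), t = \sum_(x <- s) x.1 *: (x.2.1 *t x.2.2).
Proof.
rewrite -[t]lmod_reprK; set g := lmod_repr t.
exists [seq (g@_k, k) | k <- msupp g]; rewrite big_map /=.
rewrite {1}[g]monalgE linear_sum /=; apply: eq_bigr => -[u v] _ /=.
rewrite tens_unlock -linearZ /=; congr lmod_pi; apply/malgP => k.
by rewrite mcoeffZ !mcoeffU mulrnAr mulr1.
Qed.

Variable W : lmodType K.

Fact tens_lift_key : unit. Proof. by []. Qed.

(* The linear map [tensor U V -> W] induced by [b]; the value depends on the   *)
(* chosen representative unless [b] is bilinear.                               *)
Definition tens_lift : (U -> V -> W) -> tensor U V -> W :=
  locked_with tens_lift_key (fun b t =>
    let g := lmod_repr t in \sum_(k <- msupp g) g@_k *: b k.1 k.2).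

Lemma tens_lift_unlock b t : tens_lift b t =
  \sum_(k <- msupp (lmod_repr t)) (lmod_repr t)@_k *: b k.1 k.2.
Proof. by rewrite /tens_lift unlock. Qed.

Lemma tens_lift_lin (b b1 b2 : U -> V -> W) c :
    (forall u v, b u v = c *: b1 u v + b2 u v) ->
  forall t, tens_lift b t = c *: tens_lift b1 t + tens_lift b2 t.
Proof.
move=> bE t; rewrite !tens_lift_unlock scaler_sumr -big_split.
by apply: eq_bigr => k _ /=; rewrite bE scalerDr !scalerA [c * _]mulrC.
Qed.

Variable b : U -> V -> W.

Definition bilin := (forall v, linear (b^~ v)) /\ (forall u, linear (b u)).

Hypothesis bB : bilin.

Let pre_lift (g : pre_tensor U V) : W := \sum_(k <- msupp g) g@_k *: b k.1 k.2.

Let pre_liftEw (d : {fset U * V}) g : (msupp g `<=` d)%fset ->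
  pre_lift g = \sum_(k <- d) g@_k *: b k.1 k.2.
Proof.
move=> le; rewrite /pre_lift (big_fset_incl _ le) //= => x _ /mcoeff_outdom ->.
by rewrite scale0r.
Qed.

Let pre_lift_linear : linear pre_lift.
Proof.
move=> c g h; set d := (msupp (c *: g + h) `|` msupp g `|` msupp h)%fset.
rewrite !(@pre_liftEw d) /d; first last.
- by rewrite -fsetUA fsubsetUl.
- by rewrite -fsetUA fsetUCA fsubsetUl.
- by rewrite fsubsetUr.
rewrite scaler_sumr -big_split; apply: eq_bigr => k _ /=.
by rewrite mcoeffD mcoeffZ scalerDl scalerA.
Qed.

Let pre_lift0 : pre_lift 0 = 0.
Proof. by have := pre_lift_linear (-1) 0 0; rewrite scaler0 addr0 scaleN1r addNr. Qed.

Let pre_liftB g h : pre_lift (g - h) = pre_lift g - pre_lift h.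
Proof.
have -> : g - h = -1 *: h + g by rewrite addrC scaleN1r.
by rewrite pre_lift_linear scaleN1r addrC.
Qed.

Let pre_lift_tens u v : pre_lift (pre_tens u v) = b u v.
Proof.
by rewrite (pre_liftEw msuppU_le) big_seq_fset1 mcoeffUU scale1r.
Qed.

Let pre_lift_span g : g \in span (@tensor_rel _ U V) -> pre_lift g = 0.
Proof.
move=> /spanP; elim=> [x []||c x y _ px _ py]; last 2 first.
- exact: pre_lift0.
- by rewrite pre_lift_linear px py scaler0 addr0.
- move=> c u u' v; rewrite pre_liftB pre_lift_linear !pre_lift_tens.
  by rewrite [b _ _](bB.1 v) subrr.
- move=> c u v v'; rewrite pre_liftB pre_lift_linear !pre_lift_tens.
  by rewrite (bB.2 u) subrr.
Qed.

Let tens_lift_pi g : tens_lift b (lmod_pi _ g) = pre_lift g.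
Proof.
rewrite tens_lift_unlock -/(pre_lift _).
apply/eqP; rewrite -subr_eq0 -pre_liftB.
by apply/eqP/pre_lift_span/lmod_piE; rewrite lmod_reprK.
Qed.

Lemma tens_liftE u v : tens_lift b (u *t v) = b u v.
Proof. by rewrite tens_unlock tens_lift_pi pre_lift_tens. Qed.

Lemma tens_lift_linear : linear (tens_lift b).
Proof.
move=> c x y; rewrite -[x]lmod_reprK -[y]lmod_reprK -linearP !tens_lift_pi.
exact: pre_lift_linear.
Qed.

End TensorLift.

Section TensorTheory.
Variable K : fieldType.
Implicit Types U V W : lmodType K.

Lemma tens_ext U V W (f g : tensor U V -> W) : linear f -> linear g ->
  (forall u v, f (u *t v) = g (u *t v)) -> f =1 g.
Proof.
move=> fL gL fg t.
have L0 (h : tensor U V -> W) : linear h -> h 0 = 0.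
  by move=> hL; have := hL (-1) 0 0; rewrite scaler0 addr0 scaleN1r addNr.
have [s ->] := tensE t; elim: s => [|x s IHs]; first by rewrite big_nil !L0.
by rewrite big_cons fL gL IHs fg.
Qed.

Section TensorMap.
Variables (U U' V V' : lmodType K) (f : {linear U -> U'}) (g : {linear V -> V'}).

Definition tens_map : tensor U V -> tensor U' V' :=
  tens_lift (fun u v => f u *t g v).

Lemma tens_map_bilin : bilin (fun u v => f u *t g v).
Proof.
split=> [v c x y | u c x y] /=; rewrite linearP.
  exact: tens_linl.
exact: tens_linr.
Qed.

Lemma tens_map_linear : linear tens_map.
Proof. exact: tens_lift_linear tens_map_bilin. Qed.

HB.instance Definition _ :=
  GRing.isLinear.Build K (tensor U V) (tensor U' V') *:%R tens_map
    tens_map_linear.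

Lemma tens_mapE u v : tens_map (u *t v) = f u *t g v.
Proof. exact: tens_liftE tens_map_bilin _ _. Qed.

End TensorMap.

Section TensorAssoc.
Variables U V W : lmodType K.

Definition tens_assoc : tensor (tensor U V) W -> tensor U (tensor V W) :=
  tens_lift (fun t w => tens_lift (fun u v => u *t (v *t w)) t).

Let inner_bilin (w : W) : bilin (fun (u : U) (v : V) => u *t (v *t w)).
Proof.
split=> [v c x y | u c x y] /=; first exact: tens_linl.
by rewrite tens_linl tens_linr.
Qed.

Lemma tens_assoc_bilin :
  bilin (fun (t : tensor U V) (w : W) =>
    tens_lift (fun u v => u *t (v *t w)) t).
Proof.
split=> [w | t c w w']; first exact: tens_lift_linear (inner_bilin w).
by apply: tens_lift_lin => u v; rewrite !tens_linr.
Qed.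

Lemma tens_assoc_linear : linear tens_assoc.
Proof. exact: tens_lift_linear tens_assoc_bilin. Qed.

HB.instance Definition _ :=
  GRing.isLinear.Build K (tensor (tensor U V) W) (tensor U (tensor V W)) *:%R
    tens_assoc tens_assoc_linear.

Lemma tens_assocE u v w : tens_assoc ((u *t v) *t w) = u *t (v *t w).
Proof.
by rewrite [LHS](tens_liftE tens_assoc_bilin) (tens_liftE (inner_bilin w)).
Qed.

End TensorAssoc.

Section TensorUnit.
Variable U : lmodType K.

Definition tens_unitl : tensor K^o U -> U :=
  tens_lift (fun (c : K^o) (u : U) => c *: u).
Definition tens_unitr : tensor U K^o -> U :=
  tens_lift (fun (u : U) (c : K^o) => c *: u).

Lemma tens_unitl_bilin : bilin (fun (c : K^o) (u : U) => c *: u).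
Proof.
split=> [u c x y | a c x y] /=; first by rewrite scalerDl scalerA.
by rewrite scalerDr !scalerA mulrC.
Qed.

Lemma tens_unitr_bilin : bilin (fun (u : U) (c : K^o) => c *: u).
Proof. by case: tens_unitl_bilin. Qed.

Lemma tens_unitl_linear : linear tens_unitl.
Proof. exact: tens_lift_linear tens_unitl_bilin. Qed.

Lemma tens_unitr_linear : linear tens_unitr.
Proof. exact: tens_lift_linear tens_unitr_bilin. Qed.

HB.instance Definition _ :=
  GRing.isLinear.Build K (tensor K^o U) U *:%R tens_unitl tens_unitl_linear.
HB.instance Definition _ :=
  GRing.isLinear.Build K (tensor U K^o) U *:%R tens_unitr tens_unitr_linear.

Lemma tens_unitlE c u : tens_unitl (c *t u) = c *: u.
Proof. exact: (tens_liftE tens_unitl_bilin). Qed.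

Lemma tens_unitrE u c : tens_unitr (u *t c) = c *: u.
Proof. exact: (tens_liftE tens_unitr_bilin). Qed.

End TensorUnit.

End TensorTheory.


Lemma exists_functional (K : fieldType) (V : lmodType K) (x : V) : x != 0 ->
  exists2 f : V -> K^o, linear f & f x = 1.
Proof.
move=> x_neq0.
pose P (X : V -> Prop) :=
  (forall c u v, X u -> X v -> X (c *: u + v)) /\ ~ X x.
have [F PF totF|M [[ML Mx] Mmax]] := @classical_sets.Zorn_bigcup V P.
  split=> [c u v [X FX Xu] [Y FY Yv]|[X FX Xx]]; last by have [] := PF X FX.
  have [XY|YX] := totF X Y FX FY.
    by exists Y => //; apply: (PF Y FY).1 => //; apply: XY.
  by exists X => //; apply: (PF X FX).1 => //; apply: YX.
have MP X : (forall y, M y -> X y) -> P X -> forall y, X y -> M y.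
  move=> MX PX y Xy; apply: contrapT => My.
  by apply: Mmax PX; split=> // /(_ y Xy).
have M0 : M 0.
  pose X y := M y \/ y = 0.
  apply: (MP X); [by move=> y; left| |by right].
  split=> [c u v Xu Xv|[//|x0]]; last by rewrite x0 eqxx in x_neq0.
  case: Xu Xv => [Mu|->] [Mv|->]; rewrite ?scaler0 ?add0r ?addr0;
    [by left; apply: ML| |by left|by right].
  left; have MuB := ML (-1) u u Mu Mu; rewrite scaleN1r addNr in MuB.
  by have := ML c u 0 Mu MuB; rewrite addr0.
have MZ c u : M u -> M (c *: u) by move=> Mu; rewrite -[_ *: u]addr0; apply: ML.
have dec y : exists c : K, M (y - c *: x).
  have [My|My] := pselect (M y); first by exists 0; rewrite scale0r subr0.
  pose X z := exists c : K, M (z - c *: y).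
  have nPX : ~ P X.
    move=> PX; apply: My; apply: (MP X) => // [z Mz|].
      by exists 0; rewrite scale0r subr0.
    by exists 1; rewrite scale1r subrr.
  have [c Mc] : X x.
    apply: contrapT => Xx; apply: nPX; split=> // c u v [a Ma] [b Mb].
    exists (c * a + b); rewrite scalerDl -scalerA opprD addrACA -scalerBr.
    exact: ML.
  have c_neq0 : c != 0.
    by apply: contra_notN Mx => /eqP c0; rewrite c0 scale0r subr0 in Mc.
  exists c^-1; have := MZ (- c^-1) _ Mc.
  by rewrite scalerBr !scaleNr opprK scalerA mulVf // scale1r addrC.
have uniq y a b : M (y - a *: x) -> M (y - b *: x) -> a = b.
  move=> Ma Mb; apply: contrapT => /eqP; rewrite -subr_eq0 => ab.
  apply: Mx; have := ML (-1) _ _ Ma Mb.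
  rewrite scaleN1r opprB addrA subrK -scalerBl => /(MZ (a - b)^-1).
  by rewrite scalerA mulVf // scale1r.
have [f fP] := choice dec.
exists f => [c u v|]; last by apply: (uniq x); rewrite ?scale1r ?subrr.
apply: (uniq (c *: u + v)) => //; rewrite scalerDl -scalerA opprD addrACA -scalerBr.
exact: ML.
Qed.

Section TensorAlg.
Variables (K : fieldType) (A B : algType K).
Local Notation T := (tensor A B).

Definition tens_one : T := 1 *t 1.

(* (a (x) b) (c (x) d) = (a c) (x) (b d) *)
Fact tens_mul_key : unit. Proof. by []. Qed.
Definition tens_mul : T -> T -> T := locked_with tens_mul_key (fun x y =>
  tens_lift (fun a b => tens_lift (fun c d => (a * c) *t (b * d)) y) x).

Lemma tens_mul_unlock x y : tens_mul x y =
  tens_lift (fun a b => tens_lift (fun c d => (a * c) *t (b * d)) y) x.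
Proof. by rewrite /tens_mul unlock. Qed.

Let inner_bilin (a : A) (b : B) :
  bilin (fun (c : A) (d : B) => (a * c) *t (b * d)).
Proof.
split=> [d k x y | c k x y] /=; rewrite mulrDr -scalerAr.
  exact: tens_linl.
exact: tens_linr.
Qed.

Let outer_bilin (y : T) :
  bilin (fun a b => tens_lift (fun c d => (a * c) *t (b * d)) y).
Proof.
split=> [b k a a' | a k b b'] /=; apply: tens_lift_lin => c d.
  by rewrite mulrDl -scalerAl tens_linl.
by rewrite mulrDl -scalerAl tens_linr.
Qed.

Lemma tens_mulE a b c d :
  tens_mul (a *t b) (c *t d) = (a * c) *t (b * d).
Proof.
rewrite tens_mul_unlock (tens_liftE (outer_bilin (c *t d))).
by rewrite (tens_liftE (inner_bilin a b)).
Qed.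

Lemma tens_mul_linl (y : T) : linear (tens_mul^~ y).
Proof.
by move=> k x x'; rewrite !tens_mul_unlock (tens_lift_linear (outer_bilin y)).
Qed.

Lemma tens_mul_linr (x : T) : linear (tens_mul x).
Proof.
move=> k y z; rewrite !tens_mul_unlock; apply: tens_lift_lin => a b.
exact: (tens_lift_linear (inner_bilin a b)).
Qed.

Fact tens_mulA : associative tens_mul.
Proof.
move=> x y z; move: x; apply: tens_ext => [k x x' | k x x' | a b].
- exact: tens_mul_linl.
- by rewrite !tens_mul_linl.
move: y; apply: tens_ext => [k y y' | k y y' | a' b'].
- by rewrite tens_mul_linl tens_mul_linr.
- by rewrite tens_mul_linr tens_mul_linl.
move: z; apply: tens_ext => [k z z' | k z z' | a'' b''].
- by rewrite !tens_mul_linr.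
- by rewrite tens_mul_linr.
by rewrite !tens_mulE !mulrA.
Qed.

Fact tens_mul1t : left_id tens_one tens_mul.
Proof.
apply: tens_ext => [k x x' | // | a b]; first by rewrite tens_mul_linr.
by rewrite tens_mulE !mul1r.
Qed.

Fact tens_mult1 : right_id tens_one tens_mul.
Proof.
apply: tens_ext => [k x x' | // | a b]; first by rewrite tens_mul_linl.
by rewrite tens_mulE !mulr1.
Qed.

Fact tens_mulDl : left_distributive tens_mul +%R.
Proof. by move=> x y z; have := tens_mul_linl z 1 x y; rewrite !scale1r. Qed.

Fact tens_mulDr : right_distributive tens_mul +%R.
Proof. by move=> x y z; have := tens_mul_linr x 1 y z; rewrite !scale1r. Qed.

Fact tens_one_neq0 : tens_one != 0.
Proof.
have [f fL f1] := exists_functional (oner_neq0 A).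
have [g gL g1] := exists_functional (oner_neq0 B).
pose b (x : A) (y : B) : K^o := f x * g y.
have bB : bilin b.
  split=> [v k x y | u k x y]; rewrite /b.
    by rewrite fL mulrDl -scalerAl.
  by rewrite gL mulrDr -scalerAr.
apply/eqP => /(congr1 (tens_lift b)).
have := tens_lift_linear bB (-1) 0 0; rewrite scaler0 addr0 scaleN1r addNr => ->.
by rewrite (tens_liftE bB) /b f1 g1 mulr1 => /eqP; rewrite oner_eq0.
Qed.

HB.instance Definition _ := GRing.Zmodule_isNzRing.Build T
  tens_mulA tens_mul1t tens_mult1 tens_mulDl tens_mulDr tens_one_neq0.

Fact tens_scaleAl k (x y : T) : k *: (x * y) = (k *: x) * y.
Proof.
have lin0 : tens_mul 0 y = 0.
  by have := tens_mul_linl y (-1) 0 0; rewrite scaler0 addr0 scaleN1r addNr.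
by have := tens_mul_linl y k x 0; rewrite lin0 !addr0 => /esym.
Qed.

HB.instance Definition _ := GRing.Lmodule_isLalgebra.Build K T tens_scaleAl.

Fact tens_scaleAr k (x y : T) : k *: (x * y) = x * (k *: y).
Proof.
have lin0 : tens_mul x 0 = 0.
  by have := tens_mul_linr x (-1) 0 0; rewrite scaler0 addr0 scaleN1r addNr.
by have := tens_mul_linr x k y 0; rewrite lin0 !addr0 => /esym.
Qed.

HB.instance Definition _ := GRing.Lalgebra_isAlgebra.Build K T tens_scaleAr.

Lemma tens_mulrE (a c : A) (b d : B) :
  (a *t b) * (c *t d) = (a * c) *t (b * d).
Proof. exact: tens_mulE. Qed.

End TensorAlg.


Definition coalgebra (K : fieldType) (C : lmodType K)
    (Delta : {linear C -> tensor C C}) (eps : {linear C -> K^o}) : Prop :=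
  [/\ forall x, tens_assoc (tens_map Delta (idfun : C -> C) (Delta x))
                = tens_map (idfun : C -> C) Delta (Delta x),
      forall x, tens_unitl (tens_map eps (idfun : C -> C) (Delta x)) = x
    & forall x, tens_unitr (tens_map (idfun : C -> C) eps (Delta x)) = x].

(* The compatibility of [Delta] and [eps] with the products and units of [A]   *)
(* is carried by their type.                                                   *)
Definition bialgebra (K : fieldType) (A : algType K)
    (Delta : {lrmorphism A -> tensor A A}) (eps : {lrmorphism A -> K^o}) : Prop :=
  coalgebra Delta eps.


(* Indices are shifted to [0, n-1]: [a_ij] with [1 <= i <= j <= n] is the      *)
(* generator attached to the pair [(i-1, j-1)].                                *)
Definition Tq_index (n : nat) : Type := {ij : 'I_n * 'I_n | (ij.1 <= ij.2)%N}.
HB.instance Definition _ n := Choice.on (Tq_index n).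

Section Tq.
Variables (K : fieldType) (n : nat) (q : K).

(* For [i > j], where there is no generator, the value is 0.                   *)
Definition Tq_free_gen (i j : 'I_n) : free_alg K (Tq_index n) :=
  if insub (i, j) is Some g then free_gen K (g : Tq_index n) else 0.
Local Notation x := Tq_free_gen.

(* [Tq_rel (u - v)] for each defining relation [u = v].                        *)
Inductive Tq_rel : free_alg K (Tq_index n) -> Prop :=
| Tq_rel1 (i j k : 'I_n) of (i < j <= k)%N :
    Tq_rel (x j k * x i k - q *: (x i k * x j k))
| Tq_rel2 (j k l : 'I_n) of (j <= k < l)%N :
    Tq_rel (x j k * x j l - q *: (x j l * x j k))
| Tq_rel3 (i j k l : 'I_n) of (i < j <= l)%N & (i <= k < l)%N :
    Tq_rel (x i k * x j l - x j l * x i k)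
| Tq_rel4 (i j k l : 'I_n) of (i < j)%N & (j <= k < l)%N :
    Tq_rel (x j k * x i l - q ^+ 2 *: (x i l * x j k)).

Lemma Tq_proper : 1 \notin ideal Tq_rel.
Proof.
pose c0 : {rmorphism {malg K[{fmonom Tq_index n}]} -> K} := mcoeff mone.
have c0Z a (g : free_alg K (Tq_index n)) : c0 g = 0 -> c0 (a *: g) = 0.
  by move=> g0; rewrite /c0 /= mcoeffZ [X in a * X]g0 mulr0.
have c0x i j : c0 (x i j) = 0.
  rewrite /Tq_free_gen; case: insubP => [g _ _|_]; last exact: rmorph0.
  by rewrite /c0 /= mcoeffU fm1_eq1.
have c0xM i j k l : c0 (x i j * x k l) = 0.
  by rewrite [LHS]rmorphM [X in X * _]c0x mul0r.
apply/negP => /idealP; suff c0I g : ideal_gen Tq_rel g -> c0 g = 0.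
  by move=> /c0I /eqP; rewrite [X in X == _]rmorph1 oner_eq0.
elim=> {g} [g []||g h _ g0 _ h0|g h _ h0|g h _ h0].
- by move=> *; rewrite [LHS]rmorphB [X in X - _]c0xM [X in _ - X]c0Z ?subrr.
- by move=> *; rewrite [LHS]rmorphB [X in X - _]c0xM [X in _ - X]c0Z ?subrr.
- by move=> *; rewrite [LHS]rmorphB [X in X - _]c0xM [X in _ - X]c0xM subrr.
- by move=> *; rewrite [LHS]rmorphB [X in X - _]c0xM [X in _ - X]c0Z ?subrr.
- exact: rmorph0.
- by rewrite [LHS]rmorphB [X in X - _]g0 [X in _ - X]h0 subrr.
- by rewrite [LHS]rmorphM [X in _ * X]h0 mulr0.
- by rewrite [LHS]rmorphM [X in X * _]h0 mul0r.
Qed.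

Definition Tq : Type := alg_quot Tq_proper.
HB.instance Definition _ := GRing.Algebra.on Tq.

Definition Tq_pi : free_alg K (Tq_index n) -> Tq := alg_pi Tq_proper.

Lemma Tq_pi_linear : linear Tq_pi. Proof. exact: alg_pi_linear. Qed.
Lemma Tq_pi_monoid_morphism : monoid_morphism Tq_pi.
Proof. exact: alg_pi_monoid_morphism. Qed.

HB.instance Definition _ :=
  GRing.isLinear.Build K (free_alg K (Tq_index n)) Tq *:%R Tq_pi Tq_pi_linear.
HB.instance Definition _ := GRing.isMonoidMorphism.Build
  (free_alg K (Tq_index n)) Tq Tq_pi Tq_pi_monoid_morphism.

Lemma Tq_piE g h : (Tq_pi g = Tq_pi h) <-> g - h \in ideal Tq_rel.
Proof. exact: alg_piE. Qed.

Definition Tq_gen (i j : 'I_n) : Tq := Tq_pi (Tq_free_gen i j).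

End Tq.

(* Main.v *)
Require Import Defs.
From mathcomp Require Import all_boot all_algebra.
From HB Require Import structures.
From mathcomp Require Import finmap.
From mathcomp.multinomials Require Import monalg.

Set Implicit Arguments.
Unset Strict Implicit.
Unset Printing Implicit Defensive.

Import GRing.Theory.
Local Open Scope ring_scope.

(* Let [a] and [b] be upper triangular arrays satisfying the relations of      *)
(* [T_q(n)] in algebras [A] and [B]. The product array, with entries           *)
(* [\sum_k a_ik (x) b_kj], satisfies them too: expanding both sides of a       *)
(* relation as double sums over [(s, t)], the terms match one by one, since    *)
(* in each of the cases [s < t], [s = t], [s > t] the two tensor factors       *)
(* commute up to powers of [q] whose product is the required scalar. Together  *)
(* with the identity array, this yields [Delta] and [eps]. The coalgebra       *)
(* axioms are equalities of algebra morphisms, hence need only be checked on   *)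
(* the generators, where they are associativity and unitality of the product   *)
(* of triangular matrices.                                                     *)

(** The generators and relations enter through a universal property. By [free_lift] and
    [alg_quot_lift], every triangular array satisfying the relations extends to a morphism out of
    $T_q(n)$ ([Tq_lift]), which is unique by [Tq_lrmorphism_ext]. [tri_mul_relations], with the
    array of generators in both factors, yields [Delta]; [delta_relations] yields [eps]. Since
    [tens_map], [tens_assoc] and the unit maps respect products, uniqueness reduces the axioms to
    [tri_coassoc], [tri_counitl] and [tri_counitr]. *)

Section FreeAlgUniversal.
Variables (K : fieldType) (I : choiceType) (B : algType K).
Local Notation F := (free_alg K I).

(** Words span the free algebra, and each word is built from the empty one by multiplying by letters
    on the left. *)
Lemma free_alg_ind (P : F -> Prop) :
    (forall c x y, P x -> P y -> P (c *: x + y)) ->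
    (forall i x, P x -> P (free_gen K i * x)) -> P 1 ->
  forall x, P x.
Proof.
move=> Plin Pmul P1.
have P0 : P 0 by have := Plin (-1) 1 1 P1 P1; rewrite scaleN1r addNr.
have PM (m : {fmonom I}) : P << m >>.
  case: m => s; elim: s => [|i s IHs].
    by rewrite -fmoneE; exact: P1.
  suff <- : free_gen K i * << FMonom s >> = << FMonom (i :: s) >> :> F.
    exact: Pmul.
  by rewrite [LHS]fgmulUU mulr1 fmuE; congr << _ >>; rewrite [LHS]fmmulE.
move=> x; rewrite [x]monalgE; elim: (enum_fset _) => [|m s IHs].
  by rewrite big_nil.
rewrite big_cons; have -> : << x@_m *g m >> = x@_m *: << m >> :> F.
  by apply/malgP => k; rewrite mcoeffZ !mcoeffU mulrnAr mulr1.
exact: Plin.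
Qed.

(** A word goes to the product of the images of its letters. The linear extension is multiplicative
    because scalars are central in [B]. *)
Lemma free_lift (f : I -> B) :
  exists phi : {lrmorphism F -> B}, forall i, phi (free_gen K i) = f i.
Proof.
pose h (m : {fmonom I}) := \prod_(i <- m) f i.
have hM : mmorphism h.
  split=> [x y|]; last by rewrite /h fm1 big_nil.
  by rewrite /h fmM big_cat.
pose hm : {mmorphism {fmonom I} -> B} :=
  HB.pack h (isMultiplicative.Build _ _ h hM).
pose phi : F -> B := mmap (in_alg B) hm.
have phiM : monoid_morphism phi.
  have [pM p1] : (multiplicative phi).
    apply: commr_mmap_is_multiplicative => g m m'.
    by rewrite /GRing.comm mulr_algl mulr_algr.
  by split.
have phiL : linear phi.
  by move=> c x y; rewrite [LHS]mmapD [X in X + _]mmapZ mulr_algl.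
pose phim : {lrmorphism F -> B} := HB.pack phi
  (GRing.isLinear.Build _ _ _ _ phi phiL) (GRing.isMonoidMorphism.Build _ _ phi phiM).
exists phim => i; rewrite [LHS]mmapU [X in X * _](rmorph1 (in_alg B)) mul1r -[LHS]/(h _).
by rewrite /h fmU big_seq1.
Qed.

End FreeAlgUniversal.

Section AlgQuotUniversal.
Variables (K : fieldType) (A : algType K) (S : A -> Prop).
Variable properS : 1 \notin ideal S.

(** The kernel of [phi] is a two-sided ideal containing [S], so evaluating [phi] on a chosen
    representative does not depend on the choice. *)
Lemma alg_quot_lift (B : algType K) (phi : {lrmorphism A -> B}) :
    (forall x, S x -> phi x = 0) ->
  exists psi : {lrmorphism alg_quot properS -> B},
    forall x, psi (alg_pi properS x) = phi x.
Proof.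
move=> phiS.
have phiI x : x \in ideal S -> phi x = 0.
  move=> /idealP; elim=> {x} [x /phiS //||x y _ x0 _ y0|a x _ x0|a x _ x0].
  - exact: rmorph0.
  - by rewrite [LHS]rmorphB [X in X - _]x0 [X in _ - X]y0 subrr.
  - by rewrite [LHS]rmorphM [X in _ * X]x0 mulr0.
  - by rewrite [LHS]rmorphM [X in X * _]x0 mul0r.
pose psi (x : alg_quot properS) : B := phi (alg_repr x).
have psi_pi x : psi (alg_pi properS x) = phi x.
  apply/eqP; rewrite -subr_eq0 -rmorphB; apply/eqP/phiI.
  by apply/alg_piE; rewrite alg_reprK.
have psiL : linear psi.
  move=> c x y; rewrite -[x]alg_reprK -[y]alg_reprK -linearP !psi_pi.
  exact: linearP.
have psiM : monoid_morphism psi.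
  split=> [|x y]; first by rewrite -(rmorph1 (alg_pi properS)) psi_pi rmorph1.
  by rewrite -[x]alg_reprK -[y]alg_reprK -rmorphM !psi_pi rmorphM.
pose psim : {lrmorphism alg_quot properS -> B} := HB.pack psi
  (GRing.isLinear.Build _ _ _ _ psi psiL)
  (GRing.isMonoidMorphism.Build _ _ psi psiM).
by exists psim.
Qed.

End AlgQuotUniversal.

(** * Reduction of bilinear identities to pure tensors *)

Section BilinearMaps.
Variable K : fieldType.

Lemma tensZl (U V : lmodType K) (c : K) (u : U) (v : V) :
  (c *: u) *t v = c *: (u *t v).
Proof. exact: (scalable_linear (tens_linl v)). Qed.

Lemma tensZr (U V : lmodType K) (c : K) (u : U) (v : V) :
  u *t (c *: v) = c *: (u *t v).
Proof. exact: (scalable_linear (tens_linr u)). Qed.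

(* Rewriting with [linear_sum] leaves packed morphisms behind, and unifying    *)
(* these with [tens_map f g] or [tens_assoc] is very slow.                     *)
Lemma linear_fun_sum (U V : lmodType K) (f : U -> V) : linear f ->
  forall (I : Type) (r : seq I) (P : pred I) (F : I -> U),
    f (\sum_(i <- r | P i) F i) = \sum_(i <- r | P i) f (F i).
Proof.
move=> fL I r P F.
pose g : {linear U -> V} := HB.pack f (GRing.isLinear.Build _ _ _ _ f fL).
exact: (linear_sum g).
Qed.

Lemma tens_ext2 (U V U' V' W : lmodType K)
    (F G : tensor U V -> tensor U' V' -> W) : bilin F -> bilin G ->
    (forall u v u' v', F (u *t v) (u' *t v') = G (u *t v) (u' *t v')) ->
  forall x y, F x y = G x y.
Proof.
move=> [Fl Fr] [Gl Gr] FG x y; move: x; apply: tens_ext => // u v.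
by move: y; apply: tens_ext.
Qed.

Lemma bilin_mul (A A' : lmodType K) (C : algType K) (f : A -> C) (g : A' -> C) :
  linear f -> linear g -> bilin (fun x y => f x * g y).
Proof.
move=> fL gL; split=> [v c x y|u c x y].
  by rewrite fL mulrDl -scalerAl.
by rewrite gL mulrDr -scalerAr.
Qed.

Lemma bilin_comp (U V W W' : lmodType K) (f : W -> W') (b : U -> V -> W) :
  linear f -> bilin b -> bilin (fun x y => f (b x y)).
Proof.
by move=> fL [bl br]; split=> [v c x y|u c x y]; rewrite ?bl ?br fL.
Qed.

(** Both sides of [f (x * y) = f x * f y] are bilinear in [x] and [y], so [tens_ext2] applies. *)
Lemma tens_monoid_morphism (A B C : algType K) (f : tensor A B -> C) :
    linear f -> f 1 = 1 ->
    (forall a b a' b',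
      f ((a *t b) * (a' *t b')) = f (a *t b) * f (a' *t b')) ->
  monoid_morphism f.
Proof.
move=> fL f1 fM; split=> // x y; move: x y.
have idL (T : algType K) : linear (fun x : T => x) by [].
by apply: tens_ext2 => //; [apply: (bilin_comp fL) |]; apply: bilin_mul.
Qed.

End BilinearMaps.

(** * Canonical maps of tensor products as algebra morphisms *)

Section TensorAlgMorphisms.
Variable K : fieldType.

Lemma tens_map_monoid_morphism (A A' B B' : algType K)
    (f : {lrmorphism A -> A'}) (g : {lrmorphism B -> B'}) :
  monoid_morphism (tens_map f g).
Proof.
apply: tens_monoid_morphism; first exact: tens_map_linear.
  by rewrite tens_mapE !rmorph1.
by move=> a b a' b'; rewrite tens_mulrE !tens_mapE !rmorphM tens_mulrE.
Qed.

HB.instance Definition _ (A A' B B' : algType K)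
    (f : {lrmorphism A -> A'}) (g : {lrmorphism B -> B'}) :=
  GRing.isMonoidMorphism.Build (tensor A B) (tensor A' B') (tens_map f g)
    (tens_map_monoid_morphism f g).

Lemma tens_assoc_monoid_morphism (A B C : algType K) :
  monoid_morphism (@tens_assoc K A B C).
Proof.
have assocL := @tens_assoc_linear K A B C.
apply: tens_monoid_morphism => // [|x c y c']; first exact: tens_assocE.
have idL (T : algType K) : linear (fun x : T => x) by [].
(* The left factors [x] and [y] still lie in [tensor A B]; a second extension argument makes them
   pure as well. *)
move: x y; apply: tens_ext2.
- apply: (bilin_comp assocL); apply: (bilin_mul (tens_linl c) (tens_linl c')).
- by apply: bilin_mul => k t t'; rewrite tens_linl assocL.
by move=> a b a' b'; rewrite !(tens_mulrE, tens_assocE).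
Qed.

HB.instance Definition _ (A B C : algType K) := GRing.isMonoidMorphism.Build
  (tensor (tensor A B) C) (tensor A (tensor B C)) (@tens_assoc K A B C)
  (tens_assoc_monoid_morphism A B C).

Lemma tens_unitl_monoid_morphism (A : algType K) :
  monoid_morphism (@tens_unitl K A).
Proof.
apply: tens_monoid_morphism; first exact: tens_unitl_linear.
  by rewrite tens_unitlE scale1r.
by move=> a b a' b'; rewrite tens_mulrE !tens_unitlE -scalerAl -scalerAr scalerA.
Qed.

HB.instance Definition _ (A : algType K) := GRing.isMonoidMorphism.Build
  (tensor K^o A) A (@tens_unitl K A) (tens_unitl_monoid_morphism A).

Lemma tens_unitr_monoid_morphism (A : algType K) :
  monoid_morphism (@tens_unitr K A).
Proof.
apply: tens_monoid_morphism; first exact: tens_unitr_linear.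
  by rewrite tens_unitrE scale1r.
by move=> a b a' b'; rewrite tens_mulrE !tens_unitrE -scalerAl -scalerAr scalerA.
Qed.

HB.instance Definition _ (A : algType K) := GRing.isMonoidMorphism.Build
  (tensor A K^o) A (@tens_unitr K A) (tens_unitr_monoid_morphism A).

End TensorAlgMorphisms.

(** * The universal property of $T_q(n)$ *)

Section TqRelations.
Variables (K : fieldType) (n : nat) (q : K).

(** The index conditions involve only entries on or above the diagonal, so the values of [a] below
    it are unconstrained. *)
Definition Tq_relations (B : algType K) (a : 'I_n -> 'I_n -> B) : Prop :=
  [/\ forall i j k : 'I_n, (i < j <= k)%N -> a j k * a i k = q *: (a i k * a j k),
      forall j k l : 'I_n, (j <= k < l)%N -> a j k * a j l = q *: (a j l * a j k),
      forall i j k l : 'I_n, (i < j <= l)%N -> (i <= k < l)%N ->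
        a i k * a j l = a j l * a i k
    & forall i j k l : 'I_n, (i < j)%N -> (j <= k < l)%N ->
        a j k * a i l = q ^+ 2 *: (a i l * a j k)].

Lemma Tq_free_genE (g : Tq_index n) :
  Tq_free_gen K (val g).1 (val g).2 = free_gen K g.
Proof. by rewrite /Tq_free_gen -surjective_pairing valK. Qed.

Lemma Tq_gen_relations : Tq_relations (@Tq_gen K n q).
Proof.
have rel (u v : free_alg K (Tq_index n)) : Tq_rel q (u - v) -> Tq_pi q u = Tq_pi q v.
  by move=> ?; apply/Tq_piE/ideal_incl.
have piM (u v : free_alg K (Tq_index n)) : Tq_pi q (u * v) =
    Tq_pi q u * Tq_pi q v.
  exact: rmorphM.
have piZ c (u : free_alg K (Tq_index n)) : Tq_pi q (c *: u) = c *: Tq_pi q u.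
  exact: linearZ.
split=> [i j k ijk|j k l jkl|i j k l ijl ikl|i j k l ij jkl];
  rewrite /Tq_gen -!piM -?piZ.
- exact/rel/Tq_rel1.
- exact/rel/Tq_rel2.
- exact/rel/Tq_rel3.
- exact/rel/Tq_rel4.
Qed.

Lemma Tq_lift (B : algType K) (a : 'I_n -> 'I_n -> B) : Tq_relations a ->
  exists phi : {lrmorphism Tq n q -> B},
    forall i j : 'I_n, (i <= j)%N -> phi (Tq_gen q i j) = a i j.
Proof.
move=> [a1 a2 a3 a4].
have [phi phiE] := free_lift (fun g : Tq_index n => a (val g).1 (val g).2).
have phix (i j : 'I_n) : (i <= j)%N -> phi (Tq_free_gen K i j) = a i j.
  move=> ij; pose g : Tq_index n := Sub (i, j) ij.
  by rewrite (Tq_free_genE g) phiE.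
have phixM (i j k l : 'I_n) : (i <= j)%N -> (k <= l)%N ->
    phi (Tq_free_gen K i j * Tq_free_gen K k l) = a i j * a k l.
  by move=> ij kl; rewrite [LHS]rmorphM; congr (_ * _); apply: phix.
(* All four relations have this shape, with [c] equal to [q], [q], [1] and [q ^+ 2]. *)
have phi_rel c (i j k l i' j' k' l' : 'I_n) :
    (i <= j)%N -> (k <= l)%N -> (i' <= j')%N -> (k' <= l')%N ->
    a i j * a k l = c *: (a i' j' * a k' l') ->
  phi (Tq_free_gen K i j * Tq_free_gen K k l
    - c *: (Tq_free_gen K i' j' * Tq_free_gen K k' l')) = 0.
  move=> ij kl ij' kl' aE; apply: etrans (raddfB phi _ _) _.
  apply/eqP; rewrite subr_eq0; apply/eqP/(etrans (phixM _ _ _ _ ij kl)).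
  by rewrite aE -phixM //; apply/esym/linearZ.
have [|psi psiE] := @alg_quot_lift K _ _ (@Tq_proper K n q) B phi; last first.
  by exists psi => i j ij; rewrite [LHS]psiE phix.
move=> _ [i j k|j k l|i j k l|i j k l ij].
- move=> ijk; have /andP[ij jk] := ijk; have ik := ltnW (leq_trans ij jk).
  by apply: phi_rel => //; apply: a1.
- move=> jkl; have /andP[jk kl] := jkl; have jl := ltnW (leq_ltn_trans jk kl).
  by apply: phi_rel => //; apply: a2.
- move=> ijl ikl; have /andP[_ jl] := ijl; have /andP[ik _] := ikl.
  rewrite -[X in _ - X]scale1r; apply: phi_rel => //.
  by rewrite scale1r; apply: a3.
- move=> jkl; have /andP[jk kl] := jkl; have jl := ltnW (leq_ltn_trans jk kl).
  have il := leq_trans (ltnW ij) jl.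
  by apply: phi_rel => //; apply: a4.
Qed.

Lemma Tq_lrmorphism_ext (B : algType K) (f g : {lrmorphism Tq n q -> B}) :
    (forall i j : 'I_n, (i <= j)%N -> f (Tq_gen q i j) = g (Tq_gen q i j)) ->
  f =1 g.
Proof.
move=> fg x; rewrite -[x]alg_reprK -/(Tq_pi q _); elim/free_alg_ind: (alg_repr x).
- by move=> c u v fgu fgv; rewrite linearP !linearP /= fgu fgv.
- case=> -[i j] ij u fgu; rewrite -Tq_free_genE !rmorphM /=.
  by rewrite [X in X * _]fg // fgu.
- by rewrite !rmorph1.
Qed.

End TqRelations.

(** * Products of triangular arrays, and the identity array *)

Section Comultiplication.
Variables (K : fieldType) (n : nat) (q : K).
Hypothesis q_neq0 : q != 0.
Variables (A B : algType K) (a : 'I_n -> 'I_n -> A) (b : 'I_n -> 'I_n -> B).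

Definition tri_mul (i j : 'I_n) : tensor A B :=
  \sum_(k < n | (i <= k <= j)%N) a i k *t b k j.

(** The scalars [c] and [d] may vary with [s] and [t]; only their product must be constant for the
    two double sums to match term by term. *)
Lemma tri_mul_comm (p : K) (i j k l : 'I_n) :
    (forall s t : 'I_n, (i <= s <= j)%N -> (k <= t <= l)%N ->
      exists c d, [/\ a i s * a k t = c *: (a k t * a i s),
                      b s j * b t l = d *: (b t l * b s j) & c * d = p]) ->
  tri_mul i j * tri_mul k l = p *: (tri_mul k l * tri_mul i j).
Proof.
move=> comm; rewrite /tri_mul !big_distrlr /= exchange_big scaler_sumr /=.
apply: eq_bigr => t tP; rewrite scaler_sumr; apply: eq_bigr => s sP.
have [c [d [ac bd <-]]] := comm s t sP tP.
by rewrite !tens_mulrE ac bd tensZl tensZr scalerA.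
Qed.

Lemma tri_mul_relations :
  Tq_relations q a -> Tq_relations q b -> Tq_relations q tri_mul.
Proof.
move=> [a1 a2 a3 a4] [b1 b2 b3 b4].
(* Some factors occur in the order opposite to that of the defining relation, which is then read
   backwards at the cost of inverting its scalar. *)
have inv p (C : algType K) (x y : C) : p != 0 -> x = p *: y -> y = p^-1 *: x.
  by move=> p0 ->; rewrite scalerA mulVf // scale1r.
have q20 : q ^+ 2 != 0 by rewrite expf_neq0.
split=> [i j k|j k l|i j k l|i j k l].
- move=> /andP[ij jk]; apply: tri_mul_comm => s t /andP[js sk] /andP[it tk].
  case: (ltngtP s t) => [st|ts|/val_inj st].
  (* The fourth relation in [A] contributes [q ^+ 2], the first one reversed in [B] contributes
     [q^-1], and the product is [q]. *)
  + exists (q ^+ 2), q^-1; split; first by apply: a4; rewrite ?js.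
      by apply: inv => //; apply: b1; rewrite st.
    by rewrite expr2 mulfK.
  + exists 1, q; split; rewrite ?scale1r ?mul1r //.
      by symmetry; apply: a3; rewrite ?ij ?it.
    by apply: b1; rewrite ts.
  + subst t; exists q, 1; rewrite scale1r mulr1; split=> //.
    by apply: a1; rewrite ij.
- move=> /andP[jk kl]; apply: tri_mul_comm => s t /andP[js sk] /andP[jt tl].
  case: (ltngtP s t) => [st|ts|/val_inj st].
  + exists q, 1; rewrite scale1r mulr1; split=> //; first by apply: a2; rewrite js.
    by apply: b3; rewrite ?st ?sk.
  + exists q^-1, (q ^+ 2); split; last by rewrite expr2 mulKf.
      by apply: inv => //; apply: a2; rewrite jt.
    by apply: b4; rewrite ?sk.
  + subst t; exists 1, q; rewrite scale1r mul1r; split=> //.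
    by apply: b2; rewrite sk.
- move=> /andP[ij jl] /andP[ik kl]; rewrite -[RHS]scale1r.
  apply: tri_mul_comm => s t /andP[i_s sk] /andP[jt tl].
  case: (ltngtP s t) => [st|ts|/val_inj st].
  + exists 1, 1; rewrite !scale1r mulr1; split=> //.
      by apply: a3; rewrite ?ij ?i_s.
    by apply: b3; rewrite ?st ?sk.
  + exists (q ^+ 2)^-1, (q ^+ 2); rewrite mulVf //; split=> //.
      by apply: inv => //; apply: a4; rewrite ?jt.
    by apply: b4; rewrite ?sk.
  (* On the diagonal neither factor commutes: the first relation reversed in [A] cancels the second
     one in [B]. *)
  + subst t; exists q^-1, q; rewrite mulVf //; split=> //.
      by apply: inv => //; apply: a1; rewrite ij.
    by apply: b2; rewrite sk.
- move=> ij /andP[jk kl].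
  apply: tri_mul_comm => s t /andP[js sk] /andP[it tl].
  case: (ltngtP s t) => [st|ts|/val_inj st].
  + exists (q ^+ 2), 1; rewrite scale1r mulr1; split=> //.
      by apply: a4; rewrite ?js.
    by apply: b3; rewrite ?st ?sk.
  + exists 1, (q ^+ 2); rewrite scale1r mul1r; split=> //.
      by symmetry; apply: a3; rewrite ?ij ?it.
    by apply: b4; rewrite ?sk.
  + subst t; exists q, q; rewrite expr2; split=> //.
      by apply: a1; rewrite ij.
    by apply: b2; rewrite sk.
Qed.

End Comultiplication.

(** In relations 1, 2 and 4 each side contains a strictly upper triangular entry, which is zero;
    relation 3 is commutativity of [K]. *)
Lemma delta_relations (K : fieldType) (n : nat) (q : K) :
  Tq_relations q (fun i j : 'I_n => (i == j)%:R : K^o).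
Proof.
have d0 (i j : 'I_n) : (i < j)%N -> (i == j)%:R = 0 :> K^o.
  by rewrite ltn_neqAle => /andP[/negPf ij _]; rewrite -val_eqE /= ij.
split=> [i j k /andP[ij jk]|j k l /andP[jk kl]|i j k l _ _|i j k l ij /andP[jk kl]].
- by rewrite (d0 i k) ?(leq_trans ij) // mulr0 mul0r scaler0.
- by rewrite (d0 j l) ?(leq_ltn_trans jk) // mulr0 mul0r scaler0.
- exact: mulrC.
- by rewrite (d0 i l) ?(ltn_trans ij) ?(leq_ltn_trans jk) // mulr0 mul0r scaler0.
Qed.

(** * The coalgebra axioms on the generators *)

Section TriangularCoalgebra.
Variables (K : fieldType) (n : nat) (C : lmodType K) (a : 'I_n -> 'I_n -> C).
Variables (Delta : {linear C -> tensor C C}) (eps : {linear C -> K^o}).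
Hypothesis DeltaE : forall i j : 'I_n, (i <= j)%N ->
  Delta (a i j) = \sum_(k < n | (i <= k <= j)%N) a i k *t a k j.
Hypothesis epsE : forall i j : 'I_n, (i <= j)%N -> eps (a i j) = (i == j)%:R.

(** Both sides expand to the sum over chains [i <= l <= k <= j] of [a i l *t (a l k *t a k j)]. *)
Lemma tri_coassoc (i j : 'I_n) : (i <= j)%N ->
  tens_assoc (tens_map Delta (idfun : C -> C) (Delta (a i j)))
    = tens_map (idfun : C -> C) Delta (Delta (a i j)).
Proof.
have mapL := tens_map_linear Delta (idfun : {linear C -> C}).
have mapR := tens_map_linear (idfun : {linear C -> C}) Delta.
move=> ij; rewrite DeltaE // (linear_fun_sum mapL) (linear_fun_sum mapR).
rewrite (linear_fun_sum (@tens_assoc_linear K C C C)).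
transitivity (\sum_(k < n | (i <= k <= j)%N) \sum_(l < n | (i <= l <= k)%N)
    a i l *t (a l k *t a k j)).
  apply: eq_bigr => k /andP[ik kj].
  rewrite tens_mapE DeltaE // (linear_fun_sum (tens_linl _)).
  rewrite (linear_fun_sum (@tens_assoc_linear K C C C)).
  by apply: eq_bigr => l _; rewrite tens_assocE.
rewrite (exchange_big_dep (fun l : 'I_n => i <= l <= j)%N) /=; last first.
  by move=> k l /andP[_ kj] /andP[-> lk]; apply: leq_trans lk kj.
apply: eq_bigr => l /andP[il lj]; rewrite tens_mapE DeltaE // (linear_fun_sum (tens_linr _)).
apply: eq_bigl => k; apply/idP/idP; first by case/andP=> /andP[_ ->] /andP[_ ->].
by case/andP=> lk kj; rewrite il lk kj (leq_trans il lk).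
Qed.

(** The counit kills every term except [k = i]. *)
Lemma tri_counitl (i j : 'I_n) : (i <= j)%N ->
  tens_unitl (tens_map eps (idfun : C -> C) (Delta (a i j))) = a i j.
Proof.
move=> ij; rewrite DeltaE // (linear_fun_sum (tens_map_linear _ _)).
rewrite (linear_fun_sum (@tens_unitl_linear K C)) (bigD1 i) ?leqnn //= big1 ?addr0.
  by rewrite tens_mapE tens_unitlE epsE // eqxx scale1r.
move=> k /andP[/andP[ik _] ki].
by rewrite tens_mapE tens_unitlE epsE // eq_sym (negPf ki) scale0r.
Qed.

Lemma tri_counitr (i j : 'I_n) : (i <= j)%N ->
  tens_unitr (tens_map (idfun : C -> C) eps (Delta (a i j))) = a i j.
Proof.
move=> ij; rewrite DeltaE // (linear_fun_sum (tens_map_linear _ _)).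
rewrite (linear_fun_sum (@tens_unitr_linear K C)) (bigD1 j) ?leqnn ?andbT //= big1 ?addr0.
  by rewrite tens_mapE tens_unitrE epsE // eqxx scale1r.
move=> k /andP[/andP[_ kj] kNj].
by rewrite tens_mapE tens_unitrE epsE // (negPf kNj) scale0r.
Qed.

End TriangularCoalgebra.

Theorem theorem2p8 (K : fieldType) (charK : 2%N \notin [pchar K])
    (n : nat) (n_ge2 : (2 <= n)%N) (q : K) (q_neq0 : q != 0) :
  exists (Delta : {lrmorphism Tq n q -> tensor (Tq n q) (Tq n q)})
         (eps : {lrmorphism Tq n q -> K^o}),
    [/\ forall i j : 'I_n, (i <= j)%N ->
          Delta (Tq_gen q i j) =
          \sum_(k < n | (i <= k <= j)%N) Tq_gen q i k *t Tq_gen q k j,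
        forall i j : 'I_n, (i <= j)%N -> eps (Tq_gen q i j) = (i == j)%:R
      & bialgebra Delta eps].
Proof.
have genR := @Tq_gen_relations K n q.
have [Delta DeltaE] := Tq_lift (tri_mul_relations q_neq0 genR genR).
have [eps epsE] := Tq_lift (@delta_relations K n q).
exists Delta, eps; split=> //; split.
(* Packing each composite as an algebra morphism lets [Tq_lrmorphism_ext] reduce the axiom to
   generators. *)
- pose f : {lrmorphism _ -> _} :=
    @tens_assoc K _ _ _ \o tens_map Delta (idfun : Tq n q -> Tq n q) \o Delta.
  pose g : {lrmorphism _ -> _} :=
    tens_map (idfun : Tq n q -> Tq n q) Delta \o Delta.
  apply: (@Tq_lrmorphism_ext _ _ _ _ f g) => i j ij.
  exact: tri_coassoc DeltaE _ _ ij.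
- pose f : {lrmorphism _ -> _} :=
    @tens_unitl K _ \o tens_map eps (idfun : Tq n q -> Tq n q) \o Delta.
  apply: (@Tq_lrmorphism_ext _ _ _ _ f idfun) => i j ij.
  exact: tri_counitl DeltaE epsE _ _ ij.
- pose f : {lrmorphism _ -> _} :=
    @tens_unitr K _ \o tens_map (idfun : Tq n q -> Tq n q) eps \o Delta.
  apply: (@Tq_lrmorphism_ext _ _ _ _ f idfun) => i j ij.
  exact: tri_counitr DeltaE epsE _ _ ij.
Qed.
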